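(* Let $(\mathcal{I},\mathcal{O},\Delta)$ be a task and let $\mathsf{Exec}$ be the set of full-information executions of a model of computation with initial configurations chosen according to $\mathcal{I}$, with protocol complex $\mathcal{P}$ and execution map $\Xi:\mathcal{I}\to2^{\mathcal{P}}$. The task $(\mathcal{I},\mathcal{O},\Delta)$ is solvable if and only if there exists a continuous chromatic simplicial map $\delta:\mathcal{P}\to\mathcal{O}$ such that $\delta\circ\Xi$ is carried by $\Delta$.
   Context: **Complexes and tasks.** $\Pi$ is a set of $n$ processes. A simplicial complex is a (possibly infinite) collection of finite subsets (simplexes) of a vertex set, closed under containment; it is chromatic if its vertices are colored by a map $\chi$ to $\Pi$ with distinct vertices of a simplex having distinct colors. A simplicial map is a vertex map carrying simplexes to simplexes; it is chromatic if it preserves colors. A carrier map sends each simplex to a subcomplex, monotonically with respect to inclusion; it is chromatic if the image of $\sigma$ is pure of dimension $\dim\sigma$ with every facet having color set $\chi[\sigma]$. A task is a triple $(\mathcal{I},\mathcal{O},\Delta)$ where $\mathcal{I},\mathcal{O}$ are finite pure chromatic complexes of dimension $n-1$ with vertices also labeled (labels $\ell$) by elements of $V^{\mathrm{in}}$, $V^{\mathrm{out}}$ respectively, each vertex being determined by its color and label ($v(p,x)$ denotes the vertex with color $p$ and label $x$), and $\Delta$ is a chromatic carrier map from $\mathcal{I}$ to $\mathcal{O}$. **System model.** $\mathsf{Exec}$ is a set of executions (sequences of configurations). Each process $p$ has a projection $\pi_p:\mathsf{Exec}\to\mathsf{View}_p$ to finite or infinite sequences of local views of $p$; the element with index $t\ge0$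 is the local view right after $p$'s $t$-th step (index $0$ is the initial state). Executions are full-information: a local view contains the process's identity, its initial value, and its whole history, in particular its preceding local views. A process with only finitely many steps in $E$ is faulty, otherwise correct; $\mathsf{Correct}(E)\subseteq\mathsf{Part}(E)\subseteq\Pi$, where $\mathsf{Part}(E)$ is the set of participating processes (those taking at least one step). $\mathsf{Init}_p(E)\in V^{\mathrm{in}}$ is the initial value of $p$, and $\{v(p,\mathsf{Init}_p(E))\mid p\in\mathsf{Part}(E)\}$ is a simplex of $\mathcal{I}$. $\mathsf{CView}_p=\{\pi_p(E)\mid E\in\mathsf{Exec},\,p\in\mathsf{Correct}(E)\}$. **Solvability.** A protocol is a function from local views to $V^{\mathrm{out}}\cup\{\perp\}$, $\perp\notin V^{\mathrm{out}}$, such that if a view is mapped to $v\in V^{\mathrm{out}}$, all its successor views are also mapped to $v$; $\mathsf{Decision}_p(E)\in V^{\mathrm{out}}$ denotes the decision value of $p$ in $E$, if any. The task is solvable if there is a protocol such that in every $E\in\mathsf{Exec}$ every correct process has a decision value and $\{v(p,\mathsf{Decision}_p(E))\mid p\in\mathsf{Correct}(E)\}\in\Delta(\sigma)$, where $\sigma=\{v(p,\mathsf{Init}_p(E))\mid p\in\mathsf{Part}(E)\}$. **Protocol complex.** $\mathsf{CView}_p$ is equipped with the metric $d_p(\alpha,\beta)=2^{-T_p(\alpha,\beta)}$, where $T_p(\alpha,\beta)$ is the smallest index at which $\alpha$ and $\beta$ differ ($\infty$ if none, with $2^{-\infty}=0$). $V(\mathcal{P})=\bigsqcup_{p\in\Pi}\mathsf{CView}_p$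 with the disjoint-union topology, vertices from $\mathsf{CView}_p$ being colored $p$. The simplexes of $\mathcal{P}$ are the sets $\{\pi_p(E)\mid p\in P\}$ with $E\in\mathsf{Exec}$ and $P\subseteq\mathsf{Correct}(E)$. Continuity of $\delta:\mathcal{P}\to\mathcal{O}$ means continuity of the vertex map $V(\mathcal{P})\to V(\mathcal{O})$, with $V(\mathcal{O})$ discrete. **Execution map.** For $\sigma\in\mathcal{I}$, $\mathsf{Compatible}(\sigma)$ is the set of $E\in\mathsf{Exec}$ with $\mathsf{Part}(E)\subseteq\chi[\sigma]$ and, for all $p\in\mathsf{Part}(E)$, $\mathsf{Init}_p(E)$ equal to the label of the vertex of $\sigma$ of color $p$. $\Xi(\sigma)=\{\{\pi_p(E)\mid p\in P\}\mid E\in\mathsf{Compatible}(\sigma),\,P\subseteq\mathsf{Correct}(E)\}$. ''$\delta\circ\Xi$ is carried by $\Delta$'' means $\delta[\tau]\in\Delta(\sigma)$ for all $\sigma\in\mathcal{I}$ and $\tau\in\Xi(\sigma)$. *)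

(* Defs.v *)
From HB Require Import structures.
From mathcomp Require Import all_boot all_order all_algebra.
From mathcomp Require Import all_classical all_reals topology.

Set Implicit Arguments.
Unset Strict Implicit.
Unset Printing Implicit Defensive.

Import Order.TTheory GRing.Theory Num.Theory.
Local Open Scope classical_set_scope.
Local Open Scope ring_scope.

(* A complex is given by its set of simplexes.  A nonempty complex contains the
   empty simplex. *)
Section Complexes.
Context {V : Type}.
Implicit Types (K L : set (set V)) (s : set V).

Definition is_complex K : Prop :=
  (forall s, K s -> finite_set s) /\
  (forall s s', K s -> s' `<=` s -> K s').

Definition vertices K : set V := [set v | K [set v]].

Definition is_chromatic {C : Type} (color : V -> C) K : Prop :=
  forall s, K s -> set_inj s color.

(* Integer-valued, so that the empty simplex has dimension -1. *)
Definition has_dim s (d : int) : Prop :=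
  exists2 k : nat, (s #= `I_k)%card & d = k%:Z - 1.

Definition facet K s : Prop :=
  K s /\ forall s', K s' -> s `<=` s' -> s' = s.

Definition is_pure (d : int) K : Prop :=
  K !=set0 /\ forall s, facet K s -> has_dim s d.

Definition subcomplex K L : Prop := is_complex K /\ K `<=` L.

End Complexes.

Definition simplicial_map {V W : Type} (K : set (set V)) (L : set (set W))
    (f : V -> W) : Prop :=
  forall s, K s -> L (f @` s).

(* Only the values of [D] on simplexes of [K] matter. *)
Definition carrier_map {V W : Type} (K : set (set V)) (L : set (set W))
    (D : set V -> set (set W)) : Prop :=
  (forall s, K s -> subcomplex (D s) L) /\
  (forall s s', K s -> K s' -> s `<=` s' -> D s `<=` D s').

Definition chromatic_carrier_map {V W C : Type} (cV : V -> C) (cW : W -> C)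
    (K : set (set V)) (L : set (set W)) (D : set V -> set (set W)) : Prop :=
  [/\ carrier_map K L D,
      forall s d, K s -> has_dim s d -> is_pure d (D s) &
      forall s t, K s -> facet (D s) t -> cW @` t = cV @` s].

(* A vertex is determined by its color and its label: v(p, x) is the pair
   [(p, x)], with color [fst] and label [snd]. *)
Record task (Pi : finType) (Vin Vout : Type) := Task {
  input : set (set (Pi * Vin)) ;
  output : set (set (Pi * Vout)) ;
  Delta : set (Pi * Vin) -> set (set (Pi * Vout)) ;
  input_complex : is_complex input ;
  input_finite : finite_set input ;
  input_chromatic : is_chromatic fst input ;
  input_pure : is_pure (#|Pi|%:Z - 1) input ;
  output_complex : is_complex output ;
  output_finite : finite_set output ;
  output_chromatic : is_chromatic fst output ;
  output_pure : is_pure (#|Pi|%:Z - 1) output ;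
  Delta_carrier : chromatic_carrier_map fst fst input output Delta
}.

Inductive fiseq (T : Type) : Type :=
| FinSeq of seq T
| InfSeq of (nat -> T).

Section Fiseq.
Context {T : Type}.
Implicit Types a b c : fiseq T.

Definition fiseq_at a (t : nat) : option T :=
  match a with FinSeq s => onth s t | InfSeq f => Some (f t) end.

Definition fiseq_take (t : nat) a : seq T :=
  match a with FinSeq s => take t s | InfSeq f => mkseq f t end.

Definition fiseq_infinite a : Prop :=
  match a with FinSeq _ => False | InfSeq _ => True end.

Definition differ a b : pred nat :=
  fun t => `[< fiseq_at a t <> fiseq_at b t >].

(* d(a, b) = 2 ^ (- T), with T the smallest index at which a and b differ. *)
Definition fiseq_dist (R : realType) a b : R :=
  match pselect (exists t, differ a b t) with
  | left h => 2 ^- ex_minn h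
  | right _ => 0
  end.

Lemma fiseq_at_inj a b : fiseq_at a =1 fiseq_at b -> a = b.
Proof.
case: a b => [s|f] [s'|g] //= e.
- by congr FinSeq; exact: eq_from_onth.
- by have := e (size s); rewrite /= onth_default.
- by have := e (size s'); rewrite /= onth_default.
- by congr InfSeq; apply: funext => t; case: (e t).
Qed.

Lemma fiseq_distxx (R : realType) a : fiseq_dist R a a = 0.
Proof.
by rewrite /fiseq_dist; case: pselect => // h; exfalso; case: h => t /asboolP.
Qed.

Lemma fiseq_dist_sym (R : realType) a b : fiseq_dist R a b = fiseq_dist R b a.
Proof.
rewrite /fiseq_dist; suff -> : differ a b = differ b a by [].
by apply/funext => t; apply: asbool_equiv_eq; split => ? /esym.
Qed.

Lemma fiseq_dist_ge0 (R : realType) a b : 0 <= fiseq_dist R a b.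
Proof.
by rewrite /fiseq_dist; case: pselect => // h; rewrite invr_ge0 exprn_ge0.
Qed.

Lemma fiseq_dist_eq0 (R : realType) a b : fiseq_dist R a b = 0 -> a = b.
Proof.
rewrite /fiseq_dist; case: pselect => [h /eqP|h _].
  by rewrite invr_eq0 expf_eq0 pnatr_eq0 andbF.
apply: fiseq_at_inj => t; apply: contrapT => H.
by apply: h; exists t; apply/asboolP.
Qed.

Lemma fiseq_dist_ub (R : realType) a b t :
  fiseq_at a t <> fiseq_at b t -> 2 ^- t <= fiseq_dist R a b.
Proof.
move=> H; rewrite /fiseq_dist; case: pselect => [h|[]]; last first.
  by exists t; apply/asboolP.
case: ex_minnP => m _ /(_ t) mt.
by rewrite lef_pV2 ?posrE ?exprn_gt0// ler_weXn2l ?ler1n// mt//; apply/asboolP.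
Qed.

Lemma fiseq_dist_triangle (R : realType) b a c :
  fiseq_dist R a c <= fiseq_dist R a b + fiseq_dist R b c.
Proof.
rewrite {1}/fiseq_dist; case: pselect => [h|h]; last first.
  by rewrite addr_ge0 ?fiseq_dist_ge0.
case: ex_minnP => m /asboolP mN _.
have [ab|ab] := pselect (fiseq_at a m = fiseq_at b m).
  rewrite -[leLHS]add0r lerD ?fiseq_dist_ge0// fiseq_dist_ub//.
  by rewrite -ab.
by rewrite -[leLHS]addr0 lerD ?fiseq_dist_ge0// fiseq_dist_ub.
Qed.

End Fiseq.

(* Executions are sequences of configurations; [proj p E] is the sequence of
   local views of [p] in [E], its element of index [t] being the local view
   right after the [t]-th step of [p].  In particular, [p] takes a step iff
   index 1 exists, and takes infinitely many steps iff the sequence is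
   infinite.  [proj] and [init] are only meaningful on [exec]. *)
Record model (Pi : finType) (Vin : Type) (I : set (set (Pi * Vin))) := Model {
  config : Type ;
  lview : Type ;
  exec : set (fiseq config) ;
  proj : Pi -> fiseq config -> fiseq lview ;
  init : Pi -> fiseq config -> Vin ;
  (* The information read off a local view: process identity, initial value,
     and list of the preceding local views. *)
  view_proc : lview -> Pi ;
  view_init : lview -> Vin ;
  view_hist : lview -> seq lview ;
  proj_initial : forall E p, exec E -> fiseq_at (proj p E) 0%N <> None ;
  full_information : forall E p t w, exec E -> fiseq_at (proj p E) t = Some w ->
    [/\ view_proc w = p, view_init w = init p E &
        view_hist w = fiseq_take t (proj p E)] ;
  init_simplex : forall E, exec E ->
    I [set (p, init p E) | p in [set p | fiseq_at (proj p E) 1%N <> None]]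
}.

Section Model.
Context {Pi : finType} {Vin : Type} {I : set (set (Pi * Vin))} {M : model I}.
Implicit Types (E : fiseq (config M)) (p : Pi).

Definition Part E : set Pi := [set p | fiseq_at (proj p E) 1%N <> None].

Definition Correct E : set Pi := [set p | fiseq_infinite (proj p E)].

Definition input_simplex E : set (Pi * Vin) :=
  [set (p, init p E) | p in Part E].

Definition CView p : set (fiseq (lview M)) :=
  [set a | exists E, [/\ exec E, Correct E p & a = proj p E]].

(* [w'] is a later local view than [w], of the same process in some execution. *)
Definition successor (w w' : lview M) : Prop :=
  exists E p s t, [/\ exec E, (s < t)%N,
    fiseq_at (proj p E) s = Some w & fiseq_at (proj p E) t = Some w'].

(* [None] stands for the undecided value. *)
Definition is_protocol {Vout : Type} (f : lview M -> option Vout) : Prop :=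
  forall w w' v, successor w w' -> f w = Some v -> f w' = Some v.

(* [decision f E p v] means that Decision_p(E) exists and is [v]. *)
Definition decision {Vout : Type} (f : lview M -> option Vout) E p
    (v : Vout) : Prop :=
  exists t w, fiseq_at (proj p E) t = Some w /\ f w = Some v.

Definition Compatible (sigma : set (Pi * Vin)) : set (fiseq (config M)) :=
  [set E | [/\ exec E, Part E `<=` fst @` sigma &
    forall p x, Part E p -> sigma (p, x) -> init p E = x]].

End Model.

Definition solvable {Pi : finType} {Vin Vout : Type} (T : task Pi Vin Vout)
    (M : model (input T)) : Prop :=
  exists2 f : lview M -> option Vout, is_protocol f &
    forall E, exec E ->
      (forall p, Correct E p -> exists v, decision f E p v) /\
      Delta T (input_simplex E)
        [set pv | Correct E pv.1 /\ decision f E pv.1 pv.2].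

(* The carrier of CView_p.  It mentions [R] so that it can be given the
   real-valued metric canonically. *)
Definition cview (R : realType) (Pi : finType) (Vin : Type)
    (I : set (set (Pi * Vin))) (M : model I) (p : Pi) : Type :=
  {a : fiseq (lview M) | CView p a}.

Section CViewMetric.
Context {R : realType} {Pi : finType} {Vin : Type} {I : set (set (Pi * Vin))}.
Context {M : model I} {p : Pi}.
Implicit Types a b c : cview R M p.

HB.instance Definition _ := gen_eqMixin (cview R M p).
HB.instance Definition _ := gen_choiceMixin (cview R M p).

Definition cview_dist a b : R := fiseq_dist R (sval a) (sval b).

Lemma cview_distxx a : cview_dist a a = 0.
Proof. exact: fiseq_distxx. Qed.

Lemma cview_dist_eq0 a b : cview_dist a b = 0 -> a = b.
Proof.
by case: a b => [a Pa] [b Pb] /fiseq_dist_eq0 /= ab; exact: eq_exist.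
Qed.

Lemma cview_dist_sym a b : cview_dist a b = cview_dist b a.
Proof. exact: fiseq_dist_sym. Qed.

Lemma cview_dist_triangle b a c :
  cview_dist a c <= cview_dist a b + cview_dist b c.
Proof. exact: fiseq_dist_triangle. Qed.

HB.instance Definition _ := isMetric.Build R (cview R M p)
  cview_distxx cview_dist_eq0 cview_dist_sym cview_dist_triangle.

End CViewMetric.

Section ProtocolComplex.
Context (R : realType) {Pi : finType} {Vin : Type} {I : set (set (Pi * Vin))}.
Context (M : model I).

(* The disjoint union of the CView_p; the color of a vertex is its first
   component.  Its canonical topology is the disjoint-union topology. *)
Definition pvertex : topologicalType := {p : Pi & cview R M p}.

(* { pi_p(E) | p in P }, for P included in Correct(E). *)
Definition view_simplex (E : fiseq (config M)) (P : set Pi) : set pvertex :=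
  [set x | P (projT1 x) /\ sval (projT2 x) = proj (projT1 x) E].

Definition protocol_complex : set (set pvertex) :=
  [set s | exists E P,
    [/\ exec E, P `<=` Correct E & s = view_simplex E P]].

Definition Xi (sigma : set (Pi * Vin)) : set (set pvertex) :=
  [set s | exists E P,
    [/\ Compatible sigma E, P `<=` Correct E & s = view_simplex E P]].

End ProtocolComplex.

Arguments protocol_complex R {Pi Vin I} M s.
Arguments Xi R {Pi Vin I} M sigma s.

Definition discrete (T : Type) : topologicalType :=
  discrete_topology {classic T}.

(* Main.v *)
(* A map into a discrete space is continuous on infinite views iff its value at
   each view is determined by a finite prefix.  A protocol decides at a finite
   index, so the decision map is continuous.  Conversely, given delta, let a
   process decide at local view w as soon as some infinite view runs through an
   earlier or equal local view w0 and all infinite views through w0 have the same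
   image under delta; by full information, w determines its whole past, so this
   depends on w only and is stable under taking successors. *)
Require Import Defs.
From mathcomp Require Import all_boot all_order all_algebra.
From mathcomp Require Import all_classical all_reals topology.
Local Open Scope classical_set_scope.
Import Order.TTheory GRing.Theory Num.Theory.
(* [proj] would otherwise be the projection of the product topology. *)
Import Defs.

(** * Prefixes of views and the metric they define *)

Section Prefixes.
Context {T : Type}.
Implicit Types a b : fiseq T.

Lemma size_fiseq_take a t : fiseq_at a t <> None -> size (fiseq_take t a) = t.
Proof.
case: a => [s|f] /= at0; last by rewrite size_mkseq.
by apply: size_takel; rewrite leqNgt; apply/negP => /ltnW /onth_default.
Qed.

Lemma onth_fiseq_take {a t s} : (s < t)%N ->
  onth (fiseq_take t a) s = fiseq_at a s.
Proof.
case: a => [l|f] st /=; first by rewrite !onthE map_take nth_take.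
by rewrite onthE -map_comp nth_mkseq.
Qed.

Definition agree t a b := forall s, (s <= t)%N -> fiseq_at a s = fiseq_at b s.

(** Since [agree t] includes index [t], a first difference, if any, comes after [t], whence the
    strict bound. *)
Lemma agree_dist (R : realType) {t a b} :
  agree t a b -> (fiseq_dist R a b < 2 ^- t)%R.
Proof.
move=> ab; rewrite /fiseq_dist; case: pselect => [h|_]; last first.
  by rewrite invr_gt0 exprn_gt0.
case: ex_minnP => m /asboolP abm _.
rewrite ltf_pV2 ?posrE ?exprn_gt0// ltr_eXn2l ?ltr1n// ltnNge.
by apply/negP => /ab.
Qed.

End Prefixes.

(** * Full information and the topology of the vertex set *)

Section ModelLemmas.
Context {R : realType} {Pi : finType} {Vin : Type} {I : set (set (Pi * Vin))}.
Context {M : model I}.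

(** A local view records its process and the list of its predecessors, and the length of that list
    is its index. *)
Lemma same_view_past {E E' : fiseq (config M)} {p p' t t' w} :
  exec E -> exec E' ->
  fiseq_at (proj p E) t = Some w -> fiseq_at (proj p' E') t' = Some w ->
  [/\ p = p', t = t' & agree t (proj p E) (proj p' E')].
Proof.
move=> xE xE' Ew E'w.
have [pw _ hw] := full_information xE Ew.
have [p'w _ h'w] := full_information xE' E'w.
have tt' : t = t'.
  rewrite -[LHS](@size_fiseq_take _ (proj p E)) ?Ew//.
  by rewrite -[RHS](@size_fiseq_take _ (proj p' E')) ?E'w// -hw h'w.
split; [by rewrite -pw|exact: tt'|move=> s].
rewrite leq_eqVlt => /orP[/eqP ->|st]; first by rewrite Ew tt' E'w.
by rewrite -(onth_fiseq_take st) -hw h'w onth_fiseq_take -?tt'.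
Qed.

Definition trace (x : pvertex R M) : fiseq (lview M) := sval (projT2 x).

Lemma traceP x : exists E : fiseq (config M),
  [/\ exec E, Correct E (projT1 x) & trace x = proj (projT1 x) E].
Proof. by case: x => p [a Pa]. Qed.

Lemma Correct_vertex {E : fiseq (config M)} {p} : exec E -> Correct E p ->
  exists2 x : pvertex R M, projT1 x = p & trace x = proj p E.
Proof.
move=> xE cE; have Ca : CView p (proj p E) by exists E.
by exists (existT _ p (exist _ (proj p E) Ca)).
Qed.

(** The open ball of radius [2 ^- t] consists of exactly the views that agree with its center up to
    and including index [t]. *)
Lemma nbhs_cviewP p (x : cview R M p) (U : set (cview R M p)) :
  nbhs x U <->
  exists t, forall y, agree t (sval x) (sval y) -> U y.
Proof.
split=> [/nbhs_ballP[e /= e0 xU]|[t xU]].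
  have [t te] : exists t, (2 ^- t < e :> R)%R.
    (* For a natural number n above 1/e, n < 2^n gives 2^(-n) < e. *)
    exists (Num.bound e^-1); rewrite -[ltRHS]invrK ltf_pV2 ?posrE ?exprn_gt0//.
      by rewrite (lt_le_trans (archi_boundP _)) ?invr_ge0 ?ltW// -natrX ltr_nat ltn_expl.
    by rewrite invr_gt0.
  exists t => y xy; apply: xU; rewrite ballEmdist /=.
  exact: lt_trans (agree_dist R xy) te.
apply/nbhs_ballP; exists (2 ^- t)%R => /=; first by rewrite invr_gt0 exprn_gt0.
move=> y; rewrite ballEmdist /= => xy; apply: xU => s st.
apply: contrapT => /(@fiseq_dist_ub _ R) /le_lt_trans /(_ xy).
by rewrite ltf_pV2 ?posrE ?exprn_gt0// ltr_eXn2l ?ltr1n// ltnNge st.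
Qed.

Lemma continuous_discreteP (D : Type) (d : pvertex R M -> discrete D) :
  continuous d <-> forall x, exists t, forall y, projT1 x = projT1 y ->
    agree t (trace x) (trace y) -> d x = d y.
Proof.
split=> [dc [p x]|dP [p x] U /principal_filterP Ux].
  have : nbhs (existT _ p x : pvertex R M) (d @^-1` [set d (existT _ p x)]).
    by apply: dc; apply/principal_filterP.
  case/nbhs_cviewP => t xt; exists t => -[q y] /= pq; subst q.
  by move=> /xt /= ->.
have [t xt] := dP (existT _ p x).
by apply/nbhs_cviewP; exists t => y xy /=; rewrite -(xt (existT _ p y)).
Qed.

End ModelLemmas.

(** * Complexes, tasks and compatible executions *)

Lemma is_complexS {V : Type} {K : set (set V)} {s s' : set V} :
  is_complex K -> K s -> s' `<=` s -> K s'.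
Proof. by case=> _; apply. Qed.

Section TaskLemmas.
Context {Pi : finType} {Vin Vout : Type} {T : task Pi Vin Vout}.

Lemma Delta_complex {s} : input T s -> is_complex (Delta T s).
Proof. by have [[+ _] _ _] := Delta_carrier T => /[apply] -[]. Qed.

Lemma Delta_output {s} : input T s -> Delta T s `<=` output T.
Proof. by have [[+ _] _ _] := Delta_carrier T => /[apply] -[]. Qed.

Lemma Delta_mono {s s'} : input T s -> input T s' -> s `<=` s' ->
  Delta T s `<=` Delta T s'.
Proof. by have [[_ +] _ _] := Delta_carrier T; apply. Qed.

Context {M : model (input T)}.

Lemma input_simplexP {E : fiseq (config M)} :
  exec E -> input T (input_simplex E).
Proof. exact: init_simplex. Qed.

Lemma Compatible_input_simplex {E : fiseq (config M)} :
  exec E -> Compatible (input_simplex E) E.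
Proof.
move=> xE; split=> // [p pE|p _ _ [_ _ [<- <-]]//].
by exists (p, init p E) => //; exists p.
Qed.

(** Together with [Delta_mono], this carries simplexes allowed for the actual inputs of [E] over to
    any input simplex [sigma]. *)
Lemma Compatible_subset {E : fiseq (config M)} {sigma} :
  Compatible sigma E -> input_simplex E `<=` sigma.
Proof.
case=> _ Ps Is _ [p pE <-].
by have [[q x] sx /= qp] := Ps _ pE; subst q; rewrite (Is _ _ pE sx).
Qed.

End TaskLemmas.

(** * From a vertex map to a protocol *)

Section Protocol_of_vertex_map.
Context {R : realType} {Pi : finType} {Vin Vout : Type}.
Context {I : set (set (Pi * Vin))} {M : model I}.
Variable label : pvertex R M -> Vout.

(* The first conjunct prevents a local view through which no infinite view runs
   from determining every value vacuously. *)
Definition determines (w : lview M) (v : Vout) : Prop :=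
  (exists (x : pvertex R M) t, fiseq_at (trace x) t = Some w) /\
  forall x t, fiseq_at (trace x) t = Some w -> label x = v.

(* Passing to a preceding local view [w0] keeps the decision stable along finite
   views, even at local views through which no infinite view runs. *)
Definition decided (w : lview M) (v : Vout) : Prop :=
  exists E p s t w0, [/\ exec E, (s <= t)%N, fiseq_at (proj p E) t = Some w,
    fiseq_at (proj p E) s = Some w0 & determines w0 v].

(** By full information the past of [w] is the same in all executions through [w], so the witness
    moves from one to another. *)
Lemma decided_past {w v} {E : fiseq (config M)} {p t} : decided w v -> exec E ->
  fiseq_at (proj p E) t = Some w ->
  exists s w0, [/\ (s <= t)%N, fiseq_at (proj p E) s = Some w0
    & determines w0 v].
Proof.
move=> [E' [p' [s [t' [w0 [xE' st' E'w E's dv]]]]]] xE Ew.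
have [pp' tt' EE'] := same_view_past xE' xE E'w Ew; subst p' t'.
by exists s, w0; split=> //; rewrite -EE'.
Qed.

(** Some infinite view runs through [w'], hence also through [w] in its past; its label is both [v]
    and [v']. *)
Lemma determines_later {E : fiseq (config M)} {p s s' w w' v v'} : exec E ->
  (s <= s')%N ->
  fiseq_at (proj p E) s = Some w -> fiseq_at (proj p E) s' = Some w' ->
  determines w v -> determines w' v' -> v = v'.
Proof.
move=> xE ss' Es Es' [_ wv] [[x [t xt]] w'v'].
have [F [xF _ xFE]] := traceP x.
rewrite -(w'v' _ _ xt); apply/esym/(wv _ s); move: xt; rewrite xFE => xt.
by have [_ _ <-] := same_view_past xE xF Es' xt.
Qed.

(** Both witnesses lie in the past of [w] within one execution, so their indices can be compared. *)
Lemma decided_uniq {w v v'} : decided w v -> decided w v' -> v = v'.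
Proof.
move=> [E [p [s [t [w0 [xE _ Et Es dv]]]]]] dv'.
have [s' [w0' [_ Es' {}dv']]] := decided_past dv' xE Et.
have [ss'|/ltnW s's] := leqP s s'; first exact: determines_later Es Es' dv dv'.
exact/esym/(determines_later xE s's Es' Es dv' dv).
Qed.

Definition vertex_protocol (w : lview M) : option Vout :=
  if pselect (exists v, decided w v) is left h then Some (sval (cid h))
  else None.

Lemma vertex_protocolP w v : vertex_protocol w = Some v <-> decided w v.
Proof.
rewrite /vertex_protocol; case: pselect => [h|h]; last by split=> // ?; case: h; exists v.
case: cid => u du /=; split=> [[<-]//|dv]; congr Some; exact: decided_uniq du dv.
Qed.

Lemma vertex_protocol_is_protocol : is_protocol vertex_protocol.
Proof.
move=> w w' v [E [p [s [t [xE st Es Et]]]]] /vertex_protocolP dv.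
have [r [w0 [rs Er {}dv]]] := decided_past dv xE Es.
apply/vertex_protocolP; exists E, p, r, t, w0; split=> //.
exact: leq_trans rs (ltnW st).
Qed.

(** The view [x] itself runs through the determining local view that lies in the past of the
    decision. *)
Lemma vertex_protocol_decision_label {E : fiseq (config M)} {x v} : exec E ->
  trace x = proj (projT1 x) E ->
  decision vertex_protocol E (projT1 x) v -> label x = v.
Proof.
move=> xE xp [t [w [Ew /vertex_protocolP dv]]].
have [s [w0 [_ Es [_ w0v]]]] := decided_past dv xE Ew.
by apply: (w0v _ s); rewrite xp.
Qed.

(** Every infinite view through the local view of [x] at index [t] agrees with [x] up to [t], so
    that local view determines [label x]. *)
Lemma label_vertex_protocol_decision {E : fiseq (config M)} {x t} : exec E ->
  Correct E (projT1 x) -> trace x = proj (projT1 x) E ->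
  (forall y, projT1 x = projT1 y -> agree t (trace x) (trace y) ->
     label x = label y) ->
  decision vertex_protocol E (projT1 x) (label x).
Proof.
move=> xE cE xp xt.
have [w Ew] : exists w, fiseq_at (proj (projT1 x) E) t = Some w.
  by move: cE; rewrite /Correct /=; case: (proj _ E) => // f _; exists (f t).
exists t, w; split=> //; apply/vertex_protocolP.
exists E, (projT1 x), t, t, w; split=> //.
split; first by exists x, t; rewrite xp.
move=> y t' yw; have [F [xF _ yF]] := traceP y; move: yw; rewrite yF => yw.
have [pq _ EF] := same_view_past xE xF Ew yw.
by apply/esym/xt => //; rewrite xp yF.
Qed.

End Protocol_of_vertex_map.

(** * From a protocol to a vertex map *)

Lemma decision_uniq {Pi : finType} {Vin Vout : Type} {I : set (set (Pi * Vin))}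
    {M : model I} {f : lview M -> option Vout} {E p v v'} :
  is_protocol f -> exec E -> decision f E p v -> decision f E p v' -> v = v'.
Proof.
move=> fP xE [t [w [Et fw]]] [t' [w' [Et' fw']]].
case: (ltngtP t t') => [lt|lt|tt'].
- suff: f w' = Some v by rewrite fw' => -[].
  by apply: fP fw; exists E, p, t, t'.
- suff: f w = Some v' by rewrite fw => -[].
  by apply: fP fw'; exists E, p, t', t.
- by move: Et fw; rewrite tt' Et' => -[<-]; rewrite fw' => -[].
Qed.

Lemma solvable_vertex_map (R : realType) {Pi : finType} {Vin Vout : Type}
    {T : task Pi Vin Vout} {M : model (input T)} :
  solvable M ->
  exists delta : pvertex R M -> discrete (vertices (output T)),
    [/\ continuous delta,
        forall x : pvertex R M, (sval (delta x)).1 = projT1 x,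
        simplicial_map (protocol_complex R M) (output T)
          (fun x => sval (delta x)) &
        forall (sigma : set (Pi * Vin)) (tau : set (pvertex R M)),
          input T sigma -> Xi R M sigma tau ->
          Delta T sigma ((fun x => sval (delta x)) @` tau)].
Proof.
move=> [f fP fS].
(* A decision depends only on the sequence of local views, so one value serves all executions that
   produce [x]. *)
have /choice[d dP] (x : pvertex R M) :
    exists v : vertices (output T),
    (sval v).1 = projT1 x /\ forall E, exec E ->
      trace x = proj (projT1 x) E -> decision f E (projT1 x) (sval v).2.
  have [E [xE cE xp]] := traceP x.
  have [/(_ _ cE)[v dv] DE] := fS E xE.
  have Ov : vertices (output T) (projT1 x, v).
    apply: Delta_output (input_simplexP xE) _ _.
    by apply: is_complexS (Delta_complex (input_simplexP xE)) DE _ => _ ->.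
  exists (exist _ (projT1 x, v) (mem_set Ov)); split=> // F xF xpF.
  by move: dv => [t [w]]; rewrite -xp xpF => ?; exists t, w.
have dXi sigma tau : input T sigma -> Xi R M sigma tau ->
    Delta T sigma ((fun x => sval (d x)) @` tau).
  move=> Is [E [P [cE PE ->]]]; have xE : exec E by case: cE.
  have /Delta_mono := input_simplexP xE.
  move=> /(_ _ Is (Compatible_subset cE)); apply.
  have [_ DE] := fS E xE.
  apply: is_complexS (Delta_complex (input_simplexP xE)) DE _.
  move=> _ [x [Px xp] <-]; have [dx1 dx2] := dP x.
  by split; rewrite /= dx1; [exact: PE|exact: dx2].
exists d; split=> //.
- apply/continuous_discreteP => x.
  have [E [xE cE xp]] := traceP x.
  have [dx1 /(_ _ xE xp) dx2] := dP x.
  (* The index [t] at which [x] has decided works for continuity: a view that agrees up to [t]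
     contains the same decided [w]. *)
  have [t [w [Et fw]]] := dx2.
  exists t => y xy agr; have [F [xF cF yp]] := traceP y.
  have [dy1 /(_ _ xF yp) dy2] := dP y.
  have vv : (sval (d x)).2 = (sval (d y)).2.
    apply: (decision_uniq fP xF) dy2; exists t, w; split=> //.
    by rewrite -yp -agr// xp.
  have : sval (d x) = sval (d y).
    by rewrite [LHS]surjective_pairing [RHS]surjective_pairing dx1 dy1 xy vv.
  by case: (d x) (d y) => [u Pu] [v Pv] /= uv; exact: eq_exist.
- by move=> x; have [] := dP x.
- move=> s [E [P [xE PE ->]]].
  apply: Delta_output (input_simplexP xE) _ _.
  (* A simplex of the protocol complex lies in [Xi] of the input simplex of its own execution. *)
  apply: dXi; first exact: input_simplexP.
  by exists E, P; split=> //; exact: Compatible_input_simplex.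
Qed.

Theorem theorem5p4 (R : realType) (Pi : finType) (Vin Vout : Type)
    (T : task Pi Vin Vout) (M : model (input T)) :
  solvable M <->
  exists delta : pvertex R M -> discrete (vertices (output T)),
    [/\ continuous delta,
        forall x : pvertex R M, (sval (delta x)).1 = projT1 x,
        simplicial_map (protocol_complex R M) (output T)
          (fun x => sval (delta x)) &
        forall (sigma : set (Pi * Vin)) (tau : set (pvertex R M)),
          input T sigma -> Xi R M sigma tau ->
          Delta T sigma ((fun x => sval (delta x)) @` tau)].
Proof.
split=> [|[d [/continuous_discreteP dc d1 _ dXi]]].
  exact: solvable_vertex_map.
pose label x := (sval (d x)).2.
exists (vertex_protocol label) => [|E xE]; first exact: vertex_protocol_is_protocol.
split=> [p cE|].
  have [x xp xE'] := Correct_vertex (R := R) xE cE; subst p.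
  have [t xt] := dc x.
  exists (label x); apply: (label_vertex_protocol_decision _ (t := t)) => //.
  by move=> y xy /(xt _ xy); rewrite /label => ->.
have Is := input_simplexP xE.
(* All correct processes are taken, so that the image of this simplex contains every decision made
   by one of them in [E]. *)
have XE : Xi R M (input_simplex E) (view_simplex (R := R) E (Correct E)).
  by exists E, (Correct E); split=> //; exact: Compatible_input_simplex.
apply: is_complexS (Delta_complex Is) (dXi _ _ Is XE) _.
move=> [p v] /= [cE dv].
have [x xp xE'] := Correct_vertex (R := R) xE cE; subst p.
exists x => //.
by rewrite [LHS]surjective_pairing d1 -(vertex_protocol_decision_label _ xE xE' dv).
Qed.
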